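(* There exists a family $(P_k)_{k\in\mathbb N}$ of polynomials on $\mathbb N$ such that, whenever $\pi$ is a derivation in $\mathrm{SAL}\omega$ of a judgment $\vdash t:A\mid$ (with empty context), the term $t$ normalizes in at most $P_{\delta(\pi)}(|t|)$ reduction steps, where $\delta(\pi)$ is the depth of $\pi$ and $|t|$ is the size of $t$.
   Context: **Terms.** There are positive variables $x,y,\dots$ and negative variables $\alpha,\beta,\dots$; $\kappa,\kappa'$ denote variables of either polarity; further constants $k_+\in\mathcal K_+,k_-\in\mathcal K_-$ may be present (they have no typing rule). Grammar: positive values $V_+::=x\mid (V,V')\mid\{V\}\mid\,!V\mid k_+$; values $V::=V_+\mid t_-$; positive terms $t_+::=V_+\mid\mu\alpha.c$; negative terms $t_-::=\alpha\mid\mu(\kappa,\kappa').c\ (\kappa\ne\kappa')\mid\mu\{\kappa\}.c\mid\mu!(\kappa).c\mid\mu x.c\mid k_-$; commands $c::=\langle t_+|t_-\rangle$, where $\langle t|u\rangle$ and $\langle u|t\rangle$ are identified. Everything is up to $\alpha$-equivalence; $|t|$ is the number of symbols of $t$. For a value $V$ and positive variables: $!^{\alpha}_{\emptyset}V=\langle !V|\alpha\rangle$, $!^{\alpha}_{S\cup\{x\}}V=\langle\mu!(x).(!^{\alpha}_SV)\,|\,x\rangle$, and $!_SV=\mu\alpha.(!^\alpha_SV)$ with $\alpha$ a fresh negative variable. **Reduction** (on whole commands, not under binders): $\langle\mu\alpha.c|t_-\rangle\to_\mu c[t_-/\alpha]$; $\langle V_+|\mu x.c\rangle\to_\mu c[V_+/x]$;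 $\langle\{V\}|\mu\{\kappa\}.c\rangle\to_\beta c[V/\kappa]$; $\langle(V,V')|\mu(\kappa,\kappa').c\rangle\to_\beta c[V/\kappa,V'/\kappa']$; $\langle\mu!(\kappa).c\,|\,!V\rangle\to_!c[V/\kappa]$ (polarities of variables and values matching). Reduction is $\to_\mu\cup\to_\beta\cup\to_!$. Since reduction is defined on commands, ''the term $t$ normalizes in at most $m$ steps'' means that the command $\langle t|\kappa\rangle$, with $\kappa$ a fresh variable of polarity opposite to $t$, normalizes in at most $m$ steps. **Kinds and constructors.** Kinds: $\sigma,\tau::=\iota\mid o^+\mid o^-\mid\sigma\to\tau$. Constructors: $T,U,A,B::=x^\tau\mid(x^\tau)^\bot\mid\lambda x^\tau.T\mid TU\mid\mathbf 0\mid\mathbf s\mid rec_\tau\mid rec_\tau^\bot\mid A\otimes B\mid A\wp B\mid\exists x^\tau.A\mid\forall x^\tau.A\mid\downarrow A\mid\uparrow A\mid\,!A\mid\,?A$. Binders bind both $x^\tau$ and $(x^\tau)^\bot$; substituting $U$ for $x^\tau$ replaces $(x^\tau)^\bot$ by $U^\bot$. Negation on kinds: $(o^+)^\bot=o^-$, $(o^-)^\bot=o^+$, $\iota^\bot=\iota$, $(\sigma\to\tau)^\bot=\sigma\to\tau^\bot$. Involutive negation on constructors: it exchanges $x^\tau$ and $(x^\tau)^\bot$, $rec_\tau$ and $rec_\tau^\bot$; $\mathbf 0^\bot=\mathbf 0$, $\mathbf s^\bot=\mathbf s$, $(\lambda x.T)^\bot=\lambda x.T^\bot$, $(TU)^\bot=T^\bot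 U$, $(A\otimes B)^\bot=A^\bot\wp B^\bot$, $(A\wp B)^\bot=A^\bot\otimes B^\bot$, $(\forall x.A)^\bot=\exists x.A^\bot$, $(\exists x.A)^\bot=\forall x.A^\bot$, $(\uparrow A)^\bot=\downarrow A^\bot$, $(\downarrow A)^\bot=\uparrow A^\bot$, $(!A)^\bot=\,?A^\bot$, $(?A)^\bot=\,!A^\bot$. Kinding: $x^\tau:\tau$; $(x^\tau)^\bot:\tau^\bot$; $\lambda x^\sigma.T:\sigma\to\tau$ if $T:\tau$; $TU:\tau$ if $T:\sigma\to\tau,U:\sigma$; $\mathbf 0:\iota$; $\mathbf s:\iota\to\iota$; $rec_\tau:\tau\to(\iota\to\tau\to\tau)\to\iota\to\tau$; $rec_\tau^\bot:\tau\to(\iota\to\tau\to\tau)\to\iota\to\tau^\bot$; for $A,B$ of kind $o^+$ or $o^-$: $A\otimes B,\ \downarrow A,\ !A:o^+$ and $A\wp B,\ \uparrow A,\ ?A:o^-$; $\forall x^\tau.A$, $\exists x^\tau.A$ have the same kind as $A$. Formulas are constructors of kind $o^+$ (positive, $P$) or $o^-$ (negative, $N$). Convertibility $\cong$ is the least equivalence relation containing $(\lambda x.T)U\cong T\{x:=U\}$; $\lambda x.Tx\cong T$ ($x$ not free in $T$); $rec_\tau T U\mathbf 0\cong T$; $rec_\tau TU(\mathbf s n)\cong U n(rec_\tau TUn)$; $rec_\tau^\bot TU\mathbf 0\cong T^\bot$; $rec_\tau^\bot TU(\mathbf sn)\cong U^\bot n(rec_\tau TUn)$; and closed under $\lambda$,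 application, $\otimes$, $\wp$, $\exists$, $\forall$. **Typing rules of $\mathrm{SAL}\omega$.** Contexts are finite sets of declarations $x:N$ (positive variable, negative formula) or $\alpha:P$ (negative variable, positive formula). Rules (premises $\Rightarrow$ conclusion): $(Ax_+)$ $\vdash x:P\mid x:P^\bot$; $(Ax_-)$ $\vdash\alpha:N\mid\alpha:N^\bot$; $(\mu_+)$ $c:(\vdash\alpha:P,\Gamma)\Rightarrow\ \vdash\mu\alpha.c:P\mid\Gamma$; $(\mu_-)$ $c:(\vdash x:N,\Gamma)\Rightarrow\ \vdash\mu x.c:N\mid\Gamma$; $(Cut)$ $\vdash t:A\mid\Gamma$ and $\vdash u:A^\bot\mid\Delta\Rightarrow\langle t|u\rangle:(\vdash\Gamma,\Delta)$; $(\otimes)$ $\vdash V:A\mid\Gamma$ and $\vdash V':B\mid\Delta\Rightarrow\ \vdash(V,V'):A\otimes B\mid\Gamma,\Delta$; $(\wp)$ $c:(\vdash\kappa:A,\kappa':B,\Gamma)\Rightarrow\ \vdash\mu(\kappa,\kappa').c:A\wp B\mid\Gamma$; $(\downarrow)$ $\vdash V:A\mid\Gamma\Rightarrow\ \vdash\{V\}:\downarrow A\mid\Gamma$; $(\uparrow)$ $c:(\vdash\kappa:A,\Gamma)\Rightarrow\ \vdash\mu\{\kappa\}.c:\uparrow A\mid\Gamma$; $(\exists)$ $\vdash t:A[T/x^\tau]\mid\Gamma$ with $T:\tau\Rightarrow\ \vdash t:\exists x^\tau.A\mid\Gamma$; $(\forall)$ $\vdash V:A\mid\Gamma$ with $x^\tau$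 not in $\Gamma\Rightarrow\ \vdash V:\forall x^\tau.A\mid\Gamma$; $(\cong)$ $c:(\vdash\kappa:A,\Gamma)$ with $A\cong B\Rightarrow c:(\vdash\kappa:B,\Gamma)$; $(W)$ $c:(\vdash\Gamma)\Rightarrow c:(\vdash\kappa:A,\Gamma)$; $(!_k)$ for each $k\in\mathbb N$: $\vdash V:A\mid x_1:N_1,\dots,x_k:N_k\Rightarrow\ \vdash\,!_{\{x_1,\dots,x_k\}}V:\,!A\mid x_1:?N_1,\dots,x_k:?N_k$; $(M_n)$ for each $n\in\mathbb N$: $c:(\vdash\kappa_1:A,\dots,\kappa_n:A,\Gamma)\Rightarrow\ \vdash\mu!(\kappa).c[\kappa/\kappa_1,\dots,\kappa/\kappa_n]:\,?A\mid\Gamma$. In two-premise rules $\Gamma,\Delta$ are disjoint. The depth $\delta(\pi)$ is the maximal number of nested $(!_k)$ rules in $\pi$. *)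

(* Defs.v *)
(* Binders are locally nameless in both layers of the calculus: free variables
   are names, bound variables are de Bruijn indices (0 = innermost binder), and
   a binder over a named variable is built by "closing" the body over that
   name.  Alpha-equivalent objects are therefore equal, and the rules can still
   mention named variables. *)
From HB Require Import structures.
From mathcomp Require Import all_boot.
From Stdlib Require Import Permutation.

Set Implicit Arguments.
Unset Strict Implicit.
Unset Printing Implicit Defensive.

Inductive pol := Pos | Neg.

Lemma pol_eq_dec (p q : pol) : {p = q} + {p <> q}.
Proof. by decide equality. Defined.

HB.instance Definition _ := hasDecEq.Build pol (compareP pol_eq_dec).

Definition opp (p : pol) : pol := match p with Pos => Neg | Neg => Pos end.

Inductive kind :=
| kiota
| ko of pol
| karr of kind & kind.

Lemma kind_eq_dec (s t : kind) : {s = t} + {s <> t}.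
Proof. by decide equality; apply: pol_eq_dec. Defined.

HB.instance Definition _ := hasDecEq.Build kind (compareP kind_eq_dec).

Fixpoint kneg (t : kind) : kind :=
  match t with
  | kiota => kiota
  | ko p => ko (opp p)
  | karr s t => karr s (kneg t)
  end.

(* [con n]: raw constructors with at most [n] dangling bound variables, so that
   [con 0] is the type of constructors and [con 1] that of binder bodies.  A
   variable is a name together with its kind, and occurs either plainly
   ([CFree], [CBound]) or negated ([CFreeN], [CBoundN]). *)
Inductive con (n : nat) : Type :=
| CFree of kind & nat
| CFreeN of kind & nat
| CBound of 'I_n
| CBoundN of 'I_n
| CLam of kind & con n.+1
| CApp of con n & con n
| CZero
| CSucc
| CRec of kind
| CRecN of kind
| CTens of con n & con n
| CPar of con n & con n
| CEx of kind & con n.+1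
| CAll of kind & con n.+1
| CDown of con n
| CUp of con n
| CBang of con n
| CWhy of con n.

Arguments CFree {n}.
Arguments CFreeN {n}.
Arguments CZero {n}.
Arguments CSucc {n}.
Arguments CRec {n}.
Arguments CRecN {n}.

Fixpoint cneg (n : nat) (T : con n) : con n :=
  match T with
  | CFree t x => CFreeN t x
  | CFreeN t x => CFree t x
  | CBound i => CBoundN i
  | CBoundN i => CBound i
  | CLam t T => CLam t (cneg T)
  | CApp T U => CApp (cneg T) U
  | CZero => CZero
  | CSucc => CSucc
  | CRec t => CRecN t
  | CRecN t => CRec t
  | CTens A B => CPar (cneg A) (cneg B)
  | CPar A B => CTens (cneg A) (cneg B)
  | CEx t A => CAll t (cneg A)
  | CAll t A => CEx t (cneg A)
  | CDown A => CUp (cneg A)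
  | CUp A => CDown (cneg A)
  | CBang A => CWhy (cneg A)
  | CWhy A => CBang (cneg A)
  end.

Lemma cnegK (n : nat) : involutive (@cneg n).
Proof.
by move=> T; elim: T => //= *; congruence.
Qed.

(* [cclose t x T]: the occurrences of the name [x] of kind [t] become bound by
   a new outermost binder, whose index at depth [n] is [n]. *)
Fixpoint cclose (t : kind) (x : nat) (n : nat) (T : con n) : con n.+1 :=
  match T with
  | CFree s y => if (s == t) && (y == x) then CBound ord_max else CFree s y
  | CFreeN s y => if (s == t) && (y == x) then CBoundN ord_max else CFreeN s y
  | CBound i => CBound (widen_ord (leqnSn n) i)
  | CBoundN i => CBoundN (widen_ord (leqnSn n) i)
  | CLam s T => CLam s (cclose t x T)
  | CApp T U => CApp (cclose t x T) (cclose t x U)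
  | CZero => CZero
  | CSucc => CSucc
  | CRec s => CRec s
  | CRecN s => CRecN s
  | CTens A B => CTens (cclose t x A) (cclose t x B)
  | CPar A B => CPar (cclose t x A) (cclose t x B)
  | CEx s A => CEx s (cclose t x A)
  | CAll s A => CAll s (cclose t x A)
  | CDown A => CDown (cclose t x A)
  | CUp A => CUp (cclose t x A)
  | CBang A => CBang (cclose t x A)
  | CWhy A => CWhy (cclose t x A)
  end.

Fixpoint cwiden (k : nat) (n : nat) (T : con n) : con (n + k) :=
  match T with
  | CFree s y => CFree s y
  | CFreeN s y => CFreeN s y
  | CBound i => CBound (lshift k i)
  | CBoundN i => CBoundN (lshift k i)
  | CLam s T => CLam s (cwiden k T : con (n + k).+1)
  | CApp T U => CApp (cwiden k T) (cwiden k U)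
  | CZero => CZero
  | CSucc => CSucc
  | CRec s => CRec s
  | CRecN s => CRecN s
  | CTens A B => CTens (cwiden k A) (cwiden k B)
  | CPar A B => CPar (cwiden k A) (cwiden k B)
  | CEx s A => CEx s (cwiden k A : con (n + k).+1)
  | CAll s A => CAll s (cwiden k A : con (n + k).+1)
  | CDown A => CDown (cwiden k A)
  | CUp A => CUp (cwiden k A)
  | CBang A => CBang (cwiden k A)
  | CWhy A => CWhy (cwiden k A)
  end.

(* The outermost bound variable is replaced by [U], and its negated occurrences
   by the negation of [U]; [U] has no dangling variable, so it needs no shift
   when it goes under binders. *)
Fixpoint copen (U : con 0) (n : nat) (T : con n.+1) : con n :=
  match T with
  | CFree s y => CFree s y
  | CFreeN s y => CFreeN s y
  | CBound i => if unlift ord_max i is Some j then CBound j else cwiden n U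
  | CBoundN i =>
      if unlift ord_max i is Some j then CBoundN j else cneg (cwiden n U)
  | CLam s T => CLam s (copen U T)
  | CApp T1 T2 => CApp (copen U T1) (copen U T2)
  | CZero => CZero
  | CSucc => CSucc
  | CRec s => CRec s
  | CRecN s => CRecN s
  | CTens A B => CTens (copen U A) (copen U B)
  | CPar A B => CPar (copen U A) (copen U B)
  | CEx s A => CEx s (copen U A)
  | CAll s A => CAll s (copen U A)
  | CDown A => CDown (copen U A)
  | CUp A => CUp (copen U A)
  | CBang A => CBang (copen U A)
  | CWhy A => CWhy (copen U A)
  end.

Definition csubst (t : kind) (x : nat) (U T : con 0) : con 0 :=
  copen U (cclose t x T).

Fixpoint cocc (t : kind) (x : nat) (n : nat) (T : con n) : bool :=
  match T with
  | CFree s y | CFreeN s y => (s == t) && (y == x)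
  | CBound _ | CBoundN _ | CZero | CSucc | CRec _ | CRecN _ => false
  | CLam _ T | CEx _ T | CAll _ T => cocc t x T
  | CApp T U | CTens T U | CPar T U => cocc t x T || cocc t x U
  | CDown T | CUp T | CBang T | CWhy T => cocc t x T
  end.

Definition rec_kind (t r : kind) : kind :=
  karr t (karr (karr kiota (karr t t)) (karr kiota r)).

Inductive kinded : con 0 -> kind -> Prop :=
| k_var t x : kinded (CFree t x) t
| k_varN t x : kinded (CFreeN t x) (kneg t)
| k_lam s t x T : kinded T t -> kinded (CLam s (cclose s x T)) (karr s t)
| k_app s t T U : kinded T (karr s t) -> kinded U s -> kinded (CApp T U) t
| k_zero : kinded CZero kiota
| k_succ : kinded CSucc (karr kiota kiota)
| k_rec t : kinded (CRec t) (rec_kind t t)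
| k_recN t : kinded (CRecN t) (rec_kind t (kneg t))
| k_tens p q A B :
    kinded A (ko p) -> kinded B (ko q) -> kinded (CTens A B) (ko Pos)
| k_par p q A B :
    kinded A (ko p) -> kinded B (ko q) -> kinded (CPar A B) (ko Neg)
| k_ex p t x A : kinded A (ko p) -> kinded (CEx t (cclose t x A)) (ko p)
| k_all p t x A : kinded A (ko p) -> kinded (CAll t (cclose t x A)) (ko p)
| k_down p A : kinded A (ko p) -> kinded (CDown A) (ko Pos)
| k_up p A : kinded A (ko p) -> kinded (CUp A) (ko Neg)
| k_bang p A : kinded A (ko p) -> kinded (CBang A) (ko Pos)
| k_why p A : kinded A (ko p) -> kinded (CWhy A) (ko Neg).

(* Deliberately no congruence for the shifts and the exponentials. *)
Inductive conv : con 0 -> con 0 -> Prop :=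
| cv_refl T : conv T T
| cv_sym T U : conv T U -> conv U T
| cv_trans T U V : conv T U -> conv U V -> conv T V
| cv_beta t x T U : conv (CApp (CLam t (cclose t x T)) U) (csubst t x U T)
| cv_eta t x T : ~~ cocc t x T ->
    conv (CLam t (cclose t x (CApp T (CFree t x)))) T
| cv_rec0 t T U : conv (CApp (CApp (CApp (CRec t) T) U) CZero) T
| cv_recS t T U n :
    conv (CApp (CApp (CApp (CRec t) T) U) (CApp CSucc n))
         (CApp (CApp U n) (CApp (CApp (CApp (CRec t) T) U) n))
| cv_recN0 t T U : conv (CApp (CApp (CApp (CRecN t) T) U) CZero) (cneg T)
| cv_recNS t T U n :
    conv (CApp (CApp (CApp (CRecN t) T) U) (CApp CSucc n))
         (CApp (CApp (cneg U) n) (CApp (CApp (CApp (CRec t) T) U) n))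
| cv_lam t x T T' :
    conv T T' -> conv (CLam t (cclose t x T)) (CLam t (cclose t x T'))
| cv_app T T' U U' : conv T T' -> conv U U' -> conv (CApp T U) (CApp T' U')
| cv_tens A A' B B' :
    conv A A' -> conv B B' -> conv (CTens A B) (CTens A' B')
| cv_par A A' B B' : conv A A' -> conv B B' -> conv (CPar A B) (CPar A' B')
| cv_ex t x A A' :
    conv A A' -> conv (CEx t (cclose t x A)) (CEx t (cclose t x A'))
| cv_all t x A A' :
    conv A A' -> conv (CAll t (cclose t x A)) (CAll t (cclose t x A')).

(* [MuN c] binds a negative variable, [MuP c] a positive one; the other binders
   carry the polarity of the variables they bind.  In [MuPair p p' c] the first
   variable has index 1 and the second one index 0. *)
Inductive lvar := Free of nat | Bound of nat.

Inductive pvalue (Kp Kn : Type) : Type :=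
| PVar of lvar
| Pair of value Kp Kn & value Kp Kn
| Down of value Kp Kn
| Bang of value Kp Kn
| PCst of Kp
with value (Kp Kn : Type) : Type :=
| VPos of pvalue Kp Kn
| VNeg of nterm Kp Kn
with pterm (Kp Kn : Type) : Type :=
| PVal of pvalue Kp Kn
| MuN of cmd Kp Kn
with nterm (Kp Kn : Type) : Type :=
| NVar of lvar
| MuPair of pol & pol & cmd Kp Kn
| MuDown of pol & cmd Kp Kn
| MuBang of pol & cmd Kp Kn
| MuP of cmd Kp Kn
| NCst of Kn
with cmd (Kp Kn : Type) : Type :=
| Cut of pterm Kp Kn & nterm Kp Kn.

Arguments PVar {Kp Kn}.
Arguments NVar {Kp Kn}.

Inductive term (Kp Kn : Type) : Type :=
| TPos of pterm Kp Kn
| TNeg of nterm Kp Kn.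

Definition term_of_value (Kp Kn : Type) (V : value Kp Kn) : term Kp Kn :=
  match V with
  | VPos W => TPos (PVal W)
  | VNeg t => TNeg t
  end.

Definition vpol (Kp Kn : Type) (V : value Kp Kn) : pol :=
  match V with VPos _ => Pos | VNeg _ => Neg end.

(* Replacement of the leaves: [f] and [g] are applied to the positive and
   negative variable occurrences, together with the number of binders above. *)
Section Traversal.
Context {Kp Kn : Type}.
Variable f : nat -> lvar -> pvalue Kp Kn.
Variable g : nat -> lvar -> nterm Kp Kn.

Fixpoint trav_pval (k : nat) (W : pvalue Kp Kn) : pvalue Kp Kn :=
  match W with
  | PVar v => f k v
  | Pair V V' => Pair (trav_val k V) (trav_val k V')
  | Down V => Down (trav_val k V)
  | Bang V => Bang (trav_val k V)
  | PCst a => PCst Kn a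
  end
with trav_val (k : nat) (V : value Kp Kn) : value Kp Kn :=
  match V with
  | VPos W => VPos (trav_pval k W)
  | VNeg t => VNeg (trav_nterm k t)
  end
with trav_pterm (k : nat) (t : pterm Kp Kn) : pterm Kp Kn :=
  match t with
  | PVal W => PVal (trav_pval k W)
  | MuN c => MuN (trav_cmd k.+1 c)
  end
with trav_nterm (k : nat) (t : nterm Kp Kn) : nterm Kp Kn :=
  match t with
  | NVar v => g k v
  | MuPair p q c => MuPair p q (trav_cmd k.+2 c)
  | MuDown p c => MuDown p (trav_cmd k.+1 c)
  | MuBang p c => MuBang p (trav_cmd k.+1 c)
  | MuP c => MuP (trav_cmd k.+1 c)
  | NCst a => NCst Kp a
  end
with trav_cmd (k : nat) (c : cmd Kp Kn) : cmd Kp Kn :=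
  match c with
  | Cut t u => Cut (trav_pterm k t) (trav_nterm k u)
  end.
End Traversal.

Definition var : Type := (pol * nat)%type.

(* [close i xs c]: all the variables of [xs] are identified and bound at index
   [i] (the index as seen from the root of [c]). *)
Definition close_lvar (p : pol) (xs : seq var) (i : nat) (v : lvar) : lvar :=
  match v with
  | Free x => if (p, x) \in xs then Bound i else Free x
  | Bound j => Bound j
  end.

Definition close (Kp Kn : Type) (i : nat) (xs : seq var) :
    cmd Kp Kn -> cmd Kp Kn :=
  trav_cmd (fun k v => PVar (close_lvar Pos xs (i + k) v))
           (fun k v => NVar (close_lvar Neg xs (i + k) v)) 0.

(* [open i V c]: the variable bound at index [i] is replaced by [V], which is
   meant to be locally closed and of the polarity of that variable. *)
Definition open (Kp Kn : Type) (i : nat) (V : value Kp Kn) :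
    cmd Kp Kn -> cmd Kp Kn :=
  trav_cmd
    (fun k v => match v, V with
                | Bound j, VPos W => if j == i + k then W else PVar v
                | _, _ => PVar v
                end)
    (fun k v => match v, V with
                | Bound j, VNeg t => if j == i + k then t else NVar v
                | _, _ => NVar v
                end) 0.

Definition lvar_fv (p : pol) (v : lvar) : seq var :=
  if v is Free x then [:: (p, x)] else [::].

Fixpoint fv_pval (Kp Kn : Type) (W : pvalue Kp Kn) : seq var :=
  match W with
  | PVar v => lvar_fv Pos v
  | Pair V V' => fv_val V ++ fv_val V'
  | Down V => fv_val V
  | Bang V => fv_val V
  | PCst _ => [::]
  end
with fv_val (Kp Kn : Type) (V : value Kp Kn) : seq var :=
  match V with
  | VPos W => fv_pval W
  | VNeg t => fv_nterm t
  end
with fv_pterm (Kp Kn : Type) (t : pterm Kp Kn) : seq var :=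
  match t with
  | PVal W => fv_pval W
  | MuN c => fv_cmd c
  end
with fv_nterm (Kp Kn : Type) (t : nterm Kp Kn) : seq var :=
  match t with
  | NVar v => lvar_fv Neg v
  | MuPair _ _ c => fv_cmd c
  | MuDown _ c => fv_cmd c
  | MuBang _ c => fv_cmd c
  | MuP c => fv_cmd c
  | NCst _ => [::]
  end
with fv_cmd (Kp Kn : Type) (c : cmd Kp Kn) : seq var :=
  match c with
  | Cut t u => fv_pterm t ++ fv_nterm u
  end.

Definition fv (Kp Kn : Type) (t : term Kp Kn) : seq var :=
  match t with TPos t => fv_pterm t | TNeg t => fv_nterm t end.

(* Number of symbols: every variable, constant, term former and pair of command
   brackets counts for one; the embeddings between syntactic classes are not
   symbols. *)
Fixpoint size_pval (Kp Kn : Type) (W : pvalue Kp Kn) : nat :=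
  match W with
  | PVar _ => 1
  | Pair V V' => (size_val V + size_val V').+1
  | Down V => (size_val V).+1
  | Bang V => (size_val V).+1
  | PCst _ => 1
  end
with size_val (Kp Kn : Type) (V : value Kp Kn) : nat :=
  match V with
  | VPos W => size_pval W
  | VNeg t => size_nterm t
  end
with size_pterm (Kp Kn : Type) (t : pterm Kp Kn) : nat :=
  match t with
  | PVal W => size_pval W
  | MuN c => (size_cmd c).+1
  end
with size_nterm (Kp Kn : Type) (t : nterm Kp Kn) : nat :=
  match t with
  | NVar _ => 1
  | MuPair _ _ c => (size_cmd c).+1
  | MuDown _ c => (size_cmd c).+1
  | MuBang _ c => (size_cmd c).+1
  | MuP c => (size_cmd c).+1
  | NCst _ => 1
  end
with size_cmd (Kp Kn : Type) (c : cmd Kp Kn) : nat :=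
  match c with
  | Cut t u => (size_pterm t + size_nterm u).+1
  end.

Definition term_size (Kp Kn : Type) (t : term Kp Kn) : nat :=
  match t with TPos t => size_pterm t | TNeg t => size_nterm t end.

(* The set of variables is given by an enumeration [xs], its head being the
   outermost variable; the positive variables are given by their names. *)
Fixpoint bang_cmd (Kp Kn : Type) (a : nat) (xs : seq nat) (V : value Kp Kn) :
    cmd Kp Kn :=
  match xs with
  | [::] => Cut (PVal (Bang V)) (NVar (Free a))
  | x :: xs' =>
      Cut (PVal (PVar (Free x)))
          (MuBang Pos (close 0 [:: (Pos, x)] (bang_cmd a xs' V)))
  end.

Definition fresh_name (xs : seq var) : nat := (\max_(x <- xs) x.2).+1.

Definition bang (Kp Kn : Type) (xs : seq nat) (V : value Kp Kn) : pterm Kp Kn :=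
  let a := fresh_name (fv_val V) in
  MuN (close 0 [:: (Neg, a)] (bang_cmd a xs V)).

Inductive red (Kp Kn : Type) : cmd Kp Kn -> cmd Kp Kn -> Prop :=
| red_mu_neg c t : red (Cut (MuN c) t) (open 0 (VNeg t) c)
| red_mu_pos W c : red (Cut (PVal W) (MuP c)) (open 0 (VPos W) c)
| red_beta_down V c :
    red (Cut (PVal (Down V)) (MuDown (vpol V) c)) (open 0 V c)
| red_beta_pair V V' c :
    red (Cut (PVal (Pair V V')) (MuPair (vpol V) (vpol V') c))
        (open 1 V (open 0 V' c))
| red_bang V c :
    red (Cut (PVal (Bang V)) (MuBang (vpol V) c)) (open 0 V c).

Inductive red_steps (Kp Kn : Type) : nat -> cmd Kp Kn -> cmd Kp Kn -> Prop :=
| steps0 c : red_steps 0 c c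
| stepsS n c c' c'' :
    red c c' -> red_steps n c' c'' -> red_steps n.+1 c c''.

Definition normal (Kp Kn : Type) (c : cmd Kp Kn) : Prop :=
  forall c', ~ red c c'.

Definition cmd_normalizes_within (Kp Kn : Type) (m : nat) (c : cmd Kp Kn) :
    Prop :=
  exists n c', [/\ n <= m, red_steps n c c' & normal c'].

Definition against (Kp Kn : Type) (t : term Kp Kn) (x : nat) : cmd Kp Kn :=
  match t with
  | TPos t => Cut t (NVar (Free x))
  | TNeg u => Cut (PVal (PVar (Free x))) u
  end.

Definition tpol (Kp Kn : Type) (t : term Kp Kn) : pol :=
  match t with TPos _ => Pos | TNeg _ => Neg end.

Definition normalizes_within (Kp Kn : Type) (m : nat) (t : term Kp Kn) : Prop :=
  forall x : nat, (opp (tpol t), x) \notin fv t ->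
  cmd_normalizes_within m (against t x).

(* A context is a finite set of declarations, listed without repetition: it is
   considered up to permutation ([dt_perm], [dc_perm]), and the rules keep the
   declared variables pairwise distinct. *)
Definition ctx : Type := seq (var * con 0).

Definition dom (G : ctx) : seq var := [seq d.1 | d <- G].

Definition disjoint_ctx (G D : ctx) : bool := ~~ has (mem (dom G)) (dom D).

(* A variable is declared with a formula of the opposite polarity. *)
Definition declares (x : var) (A : con 0) : Prop := kinded A (ko (opp x.1)).

Definition decls (p : pol) (L : seq (nat * con 0)) : ctx :=
  [seq ((p, d.1), d.2) | d <- L].

(* In [dc_cut] the positive term is on the left: as the two sides of a command
   may be swapped and [cneg] is involutive, this is the general cut. *)
Inductive dterm (Kp Kn : Type) : term Kp Kn -> con 0 -> ctx -> Type :=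
| dt_perm t A G G' : Permutation G G' -> dterm t A G -> dterm t A G'
| dt_ax_pos x P : kinded P (ko Pos) ->
    dterm (TPos (PVal (PVar (Free x)))) P [:: ((Pos, x), cneg P)]
| dt_ax_neg a N : kinded N (ko Neg) ->
    dterm (TNeg (NVar (Free a))) N [:: ((Neg, a), cneg N)]
| dt_mu_pos a c P G :
    dcmd c (((Neg, a), P) :: G) ->
    dterm (TPos (MuN (close 0 [:: (Neg, a)] c))) P G
| dt_mu_neg x c N G :
    dcmd c (((Pos, x), N) :: G) ->
    dterm (TNeg (MuP (close 0 [:: (Pos, x)] c))) N G
| dt_tens V V' A B G D :
    dterm (term_of_value V) A G -> dterm (term_of_value V') B D ->
    disjoint_ctx G D ->
    dterm (TPos (PVal (Pair V V'))) (CTens A B) (G ++ D)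
| dt_par (x y : var) c A B G :
    dcmd c ((x, A) :: (y, B) :: G) ->
    dterm (TNeg (MuPair x.1 y.1 (close 1 [:: x] (close 0 [:: y] c))))
      (CPar A B) G
| dt_down V A G :
    dterm (term_of_value V) A G ->
    dterm (TPos (PVal (Down V))) (CDown A) G
| dt_up (x : var) c A G :
    dcmd c ((x, A) :: G) ->
    dterm (TNeg (MuDown x.1 (close 0 [:: x] c))) (CUp A) G
| dt_ex p s x T A t G :
    kinded A (ko p) -> kinded T s ->
    dterm t (csubst s x T A) G ->
    dterm t (CEx s (cclose s x A)) G
| dt_all s x A V G :
    ~~ has (fun d => cocc s x d.2) G ->
    dterm (term_of_value V) A G ->
    dterm (term_of_value V) (CAll s (cclose s x A)) G
| dt_bang V A (L : seq (nat * con 0)) :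
    dterm (term_of_value V) A (decls Pos L) ->
    dterm (TPos (bang [seq d.1 | d <- L] V)) (CBang A)
      (decls Pos [seq (d.1, CWhy d.2) | d <- L])
| dt_mult p (xs : seq nat) c A G :
    kinded A (ko (opp p)) ->
    dcmd c ([seq ((p, x), A) | x <- xs] ++ G) ->
    dterm (TNeg (MuBang p (close 0 [seq (p, x) | x <- xs] c))) (CWhy A) G
with dcmd (Kp Kn : Type) : cmd Kp Kn -> ctx -> Type :=
| dc_perm c G G' : Permutation G G' -> dcmd c G -> dcmd c G'
| dc_cut t u A G D :
    dterm (TPos t) A G -> dterm (TNeg u) (cneg A) D ->
    disjoint_ctx G D ->
    dcmd (Cut t u) (G ++ D)
| dc_conv (x : var) A B c G :
    conv A B -> declares x B ->
    dcmd c ((x, A) :: G) -> dcmd c ((x, B) :: G)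
| dc_weak (x : var) A c G :
    declares x A -> x \notin dom G ->
    dcmd c G -> dcmd c ((x, A) :: G).

Fixpoint depth (Kp Kn : Type) (t : term Kp Kn) (A : con 0) (G : ctx)
    (d : dterm t A G) : nat :=
  match d with
  | dt_perm _ _ _ _ _ d => depth d
  | dt_ax_pos _ _ _ => 0
  | dt_ax_neg _ _ _ => 0
  | dt_mu_pos _ _ _ _ d => depth_cmd d
  | dt_mu_neg _ _ _ _ d => depth_cmd d
  | dt_tens _ _ _ _ _ _ d d' _ => maxn (depth d) (depth d')
  | dt_par _ _ _ _ _ _ d => depth_cmd d
  | dt_down _ _ _ d => depth d
  | dt_up _ _ _ _ d => depth_cmd d
  | dt_ex _ _ _ _ _ _ _ _ _ d => depth d
  | dt_all _ _ _ _ _ _ d => depth d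
  | dt_bang _ _ _ d => (depth d).+1
  | dt_mult _ _ _ _ _ _ d => depth_cmd d
  end
with depth_cmd (Kp Kn : Type) (c : cmd Kp Kn) (G : ctx) (d : dcmd c G) : nat :=
  match d with
  | dc_perm _ _ _ _ d => depth_cmd d
  | dc_cut _ _ _ _ _ d d' _ => maxn (depth d) (depth d')
  | dc_conv _ _ _ _ _ _ _ d => depth_cmd d
  | dc_weak _ _ _ _ _ _ d => depth_cmd d
  end.

(* Main.v *)
(* Types matter only through the affine discipline they impose.  Fix [r >= |t|]
   and weigh a command by its number of symbols, the content of each [!V]
   counting [r] times.  In a typed term a variable bound by a linear binder has
   at most one occurrence, outside the exponentials, and a variable bound by
   [MuBang] has either at most [r] occurrences outside the exponentials or one
   occurrence inside a single one.  Both properties survive reduction, because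
   only closed values are substituted, and they make each step decrease the
   weight: firing [MuBang] against [!V], of weight [r * w(V) + 1], produces
   copies of [V] of total weight at most [r * w(V)].  The initial weight is at
   most [|t| * |t| ^ depth + 2]. *)
Require Import Defs.
From mathcomp Require Import all_boot all_algebra.
From Stdlib Require Import Permutation Classical.
From mathcomp Require Import zify.

Set Implicit Arguments.
Unset Strict Implicit.
Unset Printing Implicit Defensive.

(* Mutual induction over the syntax and over derivations *)
Scheme pvalue_mut := Induction for pvalue Sort Prop
with value_mut := Induction for value Sort Prop
with pterm_mut := Induction for pterm Sort Prop
with nterm_mut := Induction for nterm Sort Prop
with cmd_mut := Induction for cmd Sort Prop.
Combined Scheme syntax_mutind from
  pvalue_mut, value_mut, pterm_mut, nterm_mut, cmd_mut.

(* The union of the five syntactic classes, so that mutual inductions have a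
   single statement. *)
Inductive expr (Kp Kn : Type) : Type :=
| EPval of pvalue Kp Kn
| EVal of value Kp Kn
| EPterm of pterm Kp Kn
| ENterm of nterm Kp Kn
| ECmd of cmd Kp Kn.

Lemma expr_mutind (Kp Kn : Type) (P : expr Kp Kn -> Prop) :
  (forall v, P (EPval (PVar v))) ->
  (forall V, P (EVal V) -> forall V', P (EVal V') -> P (EPval (Pair V V'))) ->
  (forall V, P (EVal V) -> P (EPval (Down V))) ->
  (forall V, P (EVal V) -> P (EPval (Bang V))) ->
  (forall k, P (EPval (PCst Kn k))) ->
  (forall W, P (EPval W) -> P (EVal (VPos W))) ->
  (forall t, P (ENterm t) -> P (EVal (VNeg t))) ->
  (forall W, P (EPval W) -> P (EPterm (PVal W))) ->
  (forall c, P (ECmd c) -> P (EPterm (MuN c))) ->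
  (forall v, P (ENterm (NVar v))) ->
  (forall p q c, P (ECmd c) -> P (ENterm (MuPair p q c))) ->
  (forall p c, P (ECmd c) -> P (ENterm (MuDown p c))) ->
  (forall p c, P (ECmd c) -> P (ENterm (MuBang p c))) ->
  (forall c, P (ECmd c) -> P (ENterm (MuP c))) ->
  (forall k, P (ENterm (NCst Kp k))) ->
  (forall t, P (EPterm t) -> forall u, P (ENterm u) -> P (ECmd (Cut t u))) ->
  forall e, P e.
Proof.
move=> ? ? ? ? ? ? ? ? ? ? ? ? ? ? ? ? e.
have [? [? [? [? ?]]]] : (forall W, P (EPval W)) /\ (forall V, P (EVal V)) /\
    (forall t, P (EPterm t)) /\ (forall u, P (ENterm u)) /\
    (forall c, P (ECmd c)) by apply: syntax_mutind; auto.
by case: e.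
Qed.

Scheme dterm_mut := Induction for dterm Sort Prop
with dcmd_mut := Induction for dcmd Sort Prop.
Combined Scheme derivation_mutind from dterm_mut, dcmd_mut.

(** * Weighted sums over expressions *)

Section Sum.
Context {Kp Kn : Type}.
Variables (r s : nat) (h : nat -> pol -> lvar -> nat).

(** One sum serves all the measures below: [s] is the cost of a symbol other than a variable, [h]
    that of a variable below [m] binders, and the content of a [Bang] is multiplied by [r]. With
    [s = 0] it counts occurrences, with [s = 1] it gives the weight. *)
Fixpoint sum_pval (m : nat) (W : pvalue Kp Kn) : nat :=
  match W with
  | PVar v => h m Pos v
  | Pair V V' => s + (sum_val m V + sum_val m V')
  | Down V => s + sum_val m V
  | Bang V => s + r * sum_val m V
  | PCst _ => s
  end
with sum_val (m : nat) (V : value Kp Kn) : nat :=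
  match V with
  | VPos W => sum_pval m W
  | VNeg t => sum_nterm m t
  end
with sum_pterm (m : nat) (t : pterm Kp Kn) : nat :=
  match t with
  | PVal W => sum_pval m W
  | MuN c => s + sum_cmd m.+1 c
  end
with sum_nterm (m : nat) (t : nterm Kp Kn) : nat :=
  match t with
  | NVar v => h m Neg v
  | MuPair _ _ c => s + sum_cmd m.+2 c
  | MuDown _ c => s + sum_cmd m.+1 c
  | MuBang _ c => s + sum_cmd m.+1 c
  | MuP c => s + sum_cmd m.+1 c
  | NCst _ => s
  end
with sum_cmd (m : nat) (c : cmd Kp Kn) : nat :=
  match c with
  | Cut t u => s + (sum_pterm m t + sum_nterm m u)
  end.

Definition sum (m : nat) (e : expr Kp Kn) : nat :=
  match e with
  | EPval W => sum_pval m W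
  | EVal V => sum_val m V
  | EPterm t => sum_pterm m t
  | ENterm t => sum_nterm m t
  | ECmd c => sum_cmd m c
  end.

End Sum.

Definition trav (Kp Kn : Type) (f : nat -> lvar -> pvalue Kp Kn)
    (g : nat -> lvar -> nterm Kp Kn) (k : nat) (e : expr Kp Kn) : expr Kp Kn :=
  match e with
  | EPval W => EPval (trav_pval f g k W)
  | EVal V => EVal (trav_val f g k V)
  | EPterm t => EPterm (trav_pterm f g k t)
  | ENterm t => ENterm (trav_nterm f g k t)
  | ECmd c => ECmd (trav_cmd f g k c)
  end.

Lemma eq_sum (Kp Kn : Type) r s (h h' : nat -> pol -> lvar -> nat) m
    (e : expr Kp Kn) :
  (forall m q v, h m q v = h' m q v) -> sum r s h m e = sum r s h' m e.
Proof.
by move=> eh; elim/expr_mutind: e m => //= *; congr (_ + _); auto;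
  congr (_ + _); auto.
Qed.

(** The sum is linear in [s] and [h] together, so a bound at the leaves propagates to the root. The
    form [h1 + h2 * a] is that of a substitution: [h2] counts the replaced leaves and [a] is the
    cost of what replaces each of them. *)
Lemma sum_le (Kp Kn : Type) r s s1 s2 a (h h1 h2 : nat -> pol -> lvar -> nat) m
    (e : expr Kp Kn) :
  s <= s1 + s2 * a ->
  (forall m q v, h m q v <= h1 m q v + h2 m q v * a) ->
  sum r s h m e <= sum r s1 h1 m e + sum r s2 h2 m e * a.
Proof.
move=> ls lh.
have two x y x1 y1 x2 y2 : x <= x1 + x2 * a -> y <= y1 + y2 * a ->
  x + y <= x1 + y1 + (x2 + y2) * a by nia.
have mul x x1 x2 : x <= x1 + x2 * a -> r * x <= r * x1 + r * x2 * a.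
  by rewrite -mulnA -mulnDr leq_mul2l => ->; rewrite orbT.
by elim/expr_mutind: e m => //= *; do ?apply: (two) => //; auto.
Qed.

Lemma leq_sum_expr (Kp Kn : Type) r s s' (h h' : nat -> pol -> lvar -> nat) m
    (e : expr Kp Kn) :
  s <= s' -> (forall m q v, h m q v <= h' m q v) ->
  sum r s h m e <= sum r s' h' m e.
Proof.
move=> ls lh; have := @sum_le _ _ r s s' 0 0 h h' (fun _ _ _ => 0) m e.
by rewrite !muln0 !addn0; apply=> [|m1 q v]; rewrite ?muln0 ?addn0.
Qed.

Lemma sum_const_depth (Kp Kn : Type) r s (h : pol -> lvar -> nat) m m'
    (e : expr Kp Kn) : sum r s (fun _ => h) m e = sum r s (fun _ => h) m' e.
Proof.
by elim/expr_mutind: e m m' => //= *; congr (_ + _); auto;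
  (congr (_ + _) || congr (_ * _)); auto.
Qed.

Lemma sum0 (Kp Kn : Type) r m (e : expr Kp Kn) :
  sum r 0 (fun _ _ _ => 0) m e = 0.
Proof.
elim/expr_mutind: e m => //= *;
  do ?match goal with IH : forall _, _ = 0 |- _ => rewrite IH end;
  by rewrite ?muln0.
Qed.

(* The offset [d] separates the depth seen by [h] from the one seen by the
   traversal, which differ below binders. *)
Lemma sum_trav (Kp Kn : Type) r s h (f : nat -> lvar -> pvalue Kp Kn) g d m
    (e : expr Kp Kn) :
  sum r s h m (trav f g (m + d) e) =
  sum r s (fun m q v => match q with
    | Pos => sum_pval r s h m (f (m + d) v)
    | Neg => sum_nterm r s h m (g (m + d) v)
    end) m e.
Proof.
by elim/expr_mutind: e m => //= *; congr (_ + _); auto; congr (_ + _); auto;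
  congr (_ * _); auto.
Qed.

(** * Occurrence counts and the weight *)

Definition is_bound (p : pol) (i m : nat) (q : pol) (v : lvar) : nat :=
  if v is Bound j then (q == p) && (j == i + m) : nat else 0.

(* [occ r p i m e]: an occurrence inside [k] nested [!V] counts for [r ^ k]. *)
Definition occ (Kp Kn : Type) r p i m (e : expr Kp Kn) : nat :=
  sum r 0 (is_bound p i) m e.

Definition weight (Kp Kn : Type) r (e : expr Kp Kn) : nat :=
  sum r 1 (fun _ _ _ => 1) 0 e.

(** Only the total [i + m] enters [is_bound], so crossing a binder amounts to renumbering the
    target. *)
Lemma occS (Kp Kn : Type) r p i m (e : expr Kp Kn) :
  occ r p i m.+1 e = occ r p i.+1 m e.
Proof.
rewrite /occ; elim/expr_mutind: e m => //=;
  try by case=> // j m; rewrite /= addnS.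
all: by move=> *; congr (_ + _); auto; (congr (_ + _) || congr (_ * _)); auto.
Qed.

(** [open] replaces only the leaves that have the polarity of the value; an occurrence of the other
    polarity would stay dangling, and the second conjunct forbids it. *)
Definition uses_at_most (Kp Kn : Type) r b p i (c : cmd Kp Kn) : bool :=
  (occ r p i 0 (ECmd c) <= b) && (occ r (Defs.opp p) i 0 (ECmd c) == 0).

(** * The affine discipline and its stability under substitution *)

Section Good.
Context {Kp Kn : Type}.
Variable r : nat.

(* Bounding [occ] by [r] at [MuBang] covers both [r] occurrences of the variable
   outside the exponentials and one occurrence inside a single [!V]. *)
Fixpoint good_pval (W : pvalue Kp Kn) : bool :=
  match W with
  | PVar _ | PCst _ => true
  | Pair V V' => good_val V && good_val V'
  | Down V | Bang V => good_val V
  end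
with good_val (V : value Kp Kn) : bool :=
  match V with
  | VPos W => good_pval W
  | VNeg t => good_nterm t
  end
with good_pterm (t : pterm Kp Kn) : bool :=
  match t with
  | PVal W => good_pval W
  | MuN c => uses_at_most r 1 Neg 0 c && good_cmd c
  end
with good_nterm (t : nterm Kp Kn) : bool :=
  match t with
  | NVar _ | NCst _ => true
  | MuPair p q c =>
      [&& uses_at_most r 1 p 1 c, uses_at_most r 1 q 0 c & good_cmd c]
  | MuDown p c => uses_at_most r 1 p 0 c && good_cmd c
  | MuBang p c => uses_at_most r r p 0 c && good_cmd c
  | MuP c => uses_at_most r 1 Pos 0 c && good_cmd c
  end
with good_cmd (c : cmd Kp Kn) : bool :=
  match c with
  | Cut t u => good_pterm t && good_nterm u
  end.

Definition good (e : expr Kp Kn) : bool :=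
  match e with
  | EPval W => good_pval W
  | EVal V => good_val V
  | EPterm t => good_pterm t
  | ENterm t => good_nterm t
  | ECmd c => good_cmd c
  end.

(** Since [i < k], the index [i] belongs to a binder already crossed by the traversal; the
    replacement of leaves must only avoid creating occurrences of such binders. *)
Lemma uses_at_most_trav b p i k f g (c : cmd Kp Kn) : i < k ->
  (forall m v p i, i < k ->
     sum_pval r 0 (is_bound p i) m (f (m + k) v) <= is_bound p i m Pos v) ->
  (forall m v p i, i < k ->
     sum_nterm r 0 (is_bound p i) m (g (m + k) v) <= is_bound p i m Neg v) ->
  uses_at_most r b p i c -> uses_at_most r b p i (trav_cmd f g k c).
Proof.
move=> ik lf lg.
have le q : occ r q i 0 (ECmd (trav_cmd f g k c)) <= occ r q i 0 (ECmd c).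
  have := sum_trav r 0 (is_bound q i) f g k 0 (ECmd c).
  rewrite add0n /occ => ->.
  by apply: leq_sum_expr => // m [] v; auto.
case/andP=> h1 /eqP h2; apply/andP; split; first exact: leq_trans (le _) h1.
by move: (le (Defs.opp p)); rewrite h2 leqn0.
Qed.

Lemma good_trav k f g (e : expr Kp Kn) :
  (forall k v, good_pval (f k v)) -> (forall k v, good_nterm (g k v)) ->
  (forall d m v p i, i < d ->
     sum_pval r 0 (is_bound p i) m (f (m + d) v) <= is_bound p i m Pos v) ->
  (forall d m v p i, i < d ->
     sum_nterm r 0 (is_bound p i) m (g (m + d) v) <= is_bound p i m Neg v) ->
  good e -> good (trav f g k e).
Proof.
move=> gf gg lf lg; elim/expr_mutind: e k => //=.
- by move=> V IH V' IH' k /andP[/IH-> /IH'->].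
- by move=> c IH k /andP[u /IH->]; rewrite andbT;
  apply: uses_at_most_trav (lf _) (lg _) u.
- move=> p q c IH k /and3P[u u' /IH->]; rewrite andbT.
  rewrite (uses_at_most_trav _ (lf _) (lg _) u) //.
  exact: uses_at_most_trav (lf _) (lg _) u'.
- by move=> p c IH k /andP[u /IH->]; rewrite andbT;
  apply: uses_at_most_trav (lf _) (lg _) u.
- by move=> p c IH k /andP[u /IH->]; rewrite andbT;
  apply: uses_at_most_trav (lf _) (lg _) u.
- by move=> c IH k /andP[u /IH->]; rewrite andbT;
  apply: uses_at_most_trav (lf _) (lg _) u.
- by move=> t IH u IH' k /andP[/IH-> /IH'->].
Qed.

(** For [r > 0] this is local closure: free names are allowed, dangling indices are not. *)
Definition closed (e : expr Kp Kn) : Prop := forall p i m, occ r p i m e = 0.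

Lemma occ_open p j i V (c : cmd Kp Kn) : closed (EVal V) ->
  occ r p j 0 (ECmd (open i V c)) <=
  if (p == vpol V) && (j == i) then 0 else occ r p j 0 (ECmd c).
Proof.
move=> clV; rewrite /occ /open.
rewrite -[ECmd (trav_cmd _ _ _ _)]/(trav _ _ (0 + 0) (ECmd c)) sum_trav.
have [/andP[/eqP-> /eqP->]|npj] := ifP.
  rewrite -[X in _ <= X](@sum0 Kp Kn r 0 (ECmd c)).
  apply: leq_sum_expr => // m q v.
  case: q v => -[x|n] //=; case: V clV => [W|t] clV //=; rewrite ?addn0.
  - by case: eqP => [_|/eqP/negPf /= ->] //;
    have /= := clV Pos i m; rewrite /occ /= => ->.
  - by case: eqP => [_|/eqP/negPf /= ->] //;
    have /= := clV Neg i m; rewrite /occ /= => ->.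
apply: leq_sum_expr => // m q v.
case: q v => -[x|n] //=; case: V clV npj => [W|t] clV npj //=; rewrite ?addn0.
- by case: eqP => // _; have /= := clV p j m; rewrite /occ /= => ->.
- by case: eqP => // _; have /= := clV p j m; rewrite /occ /= => ->.
Qed.

(** A copy of [V] placed inside [k] exponentials contributes [r ^ k] times the weight of [V], which
    is exactly how [occ] counts the occurrence it replaces. *)
Lemma weight_open i V (c : cmd Kp Kn) :
  weight r (ECmd (open i V c)) <=
  weight r (ECmd c) + occ r (vpol V) i 0 (ECmd c) * weight r (EVal V).
Proof.
have weight_at m : sum r 1 (fun _ _ _ => 1) m (EVal V) = weight r (EVal V)
  by exact: sum_const_depth.
rewrite /weight /open.
rewrite -[ECmd (trav_cmd _ _ _ _)]/(trav _ _ (0 + 0) (ECmd c)) sum_trav.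
apply: sum_le => // m q v; move: (weight_at m).
case: q v V {weight_at} => -[x|n] //= [W|t] //= e; rewrite addn0.
- by case: eqP => _ //=; rewrite e mul1n leq_addl.
- by case: eqP => _ //=; rewrite e mul1n leq_addl.
Qed.

(** Closedness of [V] rules out capture: its copies add no occurrence to the binders above them. *)
Lemma good_open i V (c : cmd Kp Kn) : closed (EVal V) -> good (EVal V) ->
  good (ECmd c) -> good (ECmd (open i V c)).
Proof.
move=> clV gV gc; apply: (@good_trav 0 _ _ (ECmd c)) => //.
- by move=> k [x|n] //; case: V clV gV => // W _ gW; case: ifP.
- by move=> k [x|n] //; case: V clV gV => // W _ gW; case: ifP.
- move=> d m [x|n] p j jd //; case: V clV gV => // W clV _ /=.
  by case: eqP => // _; have := clV p j m; rewrite /occ /= => ->.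
- move=> d m [x|n] p j jd //; case: V clV gV => // W clV _ /=.
  by case: eqP => // _; have := clV p j m; rewrite /occ /= => ->.
Qed.

End Good.

(** * Each reduction step decreases the weight *)

Section Reduction.
Context {Kp Kn : Type}.
Variable r : nat.
Hypothesis r_gt0 : 0 < r.
Local Notation expr := (expr Kp Kn).
Local Notation cmd := (cmd Kp Kn).

Lemma closed_at0 (e : expr) : (forall p i, occ r p i 0 e = 0) -> closed r e.
Proof.
move=> e0 p i m; elim: m i => [|m IH] i; first exact: e0.
by rewrite occS IH.
Qed.

(** Common to the redexes that bind one variable, with [b = 1] for the linear ones and [b = r] for
    [MuBang]. The last hypothesis makes 0 the only dangling index of [c], so filling it closes the
    command. *)
Lemma substitution_step b V (c : cmd) :
  closed r (EVal V) -> good r (EVal V) ->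
  uses_at_most r b (vpol V) 0 c -> good r (ECmd c) ->
  (forall p i, occ r p i.+1 0 (ECmd c) = 0) ->
  [/\ closed r (ECmd (open 0 V c)), good r (ECmd (open 0 V c)) &
      weight r (ECmd (open 0 V c)) <=
      weight r (ECmd c) + b * weight r (EVal V)].
Proof.
move=> clV gV /andP[u /eqP u'] gc clc; split.
- apply: closed_at0 => p i; apply/eqP; rewrite -leqn0.
  apply: leq_trans (occ_open _ _ _ _ clV) _.
  case: i => [|i]; last by rewrite andbF clc.
  by move: u u'; case: p; case: (vpol V) => //= _ ->.
- exact: good_open.
- by apply: leq_trans (weight_open _ _ _ _) _;
  rewrite leq_add2l leq_mul2r u orbT.
Qed.

(** The copies of the substituted value are paid for by its weight inside the redex, multiplied by
    [r] under [Bang]; the symbols of the redex that disappear make the inequality strict. *)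
Lemma red_decreases (c c' : cmd) :
  closed r (ECmd c) -> good r (ECmd c) -> red c c' ->
  [/\ closed r (ECmd c'), good r (ECmd c') &
      weight r (ECmd c') < weight r (ECmd c)].
Proof.
have weight1 (d : cmd) m : sum_cmd r 1 (fun _ _ _ => 1) m d = weight r (ECmd d).
  exact: (sum_const_depth _ _ _ _ _ (ECmd d)).
have body (d : cmd) : (forall p i m, sum_cmd r 0 (is_bound p i) m.+1 d = 0) ->
    forall p i, occ r p i.+1 0 (ECmd d) = 0.
  by move=> d0 p i; rewrite -occS; apply: d0.
move=> clc gc rd.
case: rd clc gc => /=.
- move=> d t cl /andP[/andP[u gd] gt].
  have [|||||? ? le] := @substitution_step 1 (VNeg t) d => //.
  + by move=> p i m; have := cl p i m; rewrite /occ /=; lia.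
  + by apply: body => p i m; have := cl p i m; rewrite /occ /=; lia.
  by split=> //; move: le; rewrite /weight /= !weight1 /weight /=; lia.
- move=> W d cl /andP[gW /andP[u gd]].
  have [|||||? ? le] := @substitution_step 1 (VPos W) d => //.
  + by move=> p i m; have := cl p i m; rewrite /occ /=; lia.
  + by apply: body => p i m; have := cl p i m; rewrite /occ /=; lia.
  by split=> //; move: le; rewrite /weight /= !weight1 /weight /=; lia.
- move=> V d cl /andP[gV /andP[u gd]].
  have [|||||? ? le] := @substitution_step 1 V d => //.
  + by move=> p i m; have := cl p i m; rewrite /occ /=; lia.
  + by apply: body => p i m; have := cl p i m; rewrite /occ /=; lia.
  by split=> //; move: le; rewrite /weight /= !weight1 /weight /=; lia.
- move=> V V' d cl /andP[/andP[gV gV']]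
    /and3P[/andP[u1 /eqP u1'] /andP[u0 /eqP u0'] gd].
  have clV : closed r (EVal V).
    by move=> p i m; have := cl p i m; rewrite /occ /=; lia.
  have clV' : closed r (EVal V').
    by move=> p i m; have := cl p i m; rewrite /occ /=; lia.
  have cld p i : occ r p i.+2 0 (ECmd d) = 0.
    by rewrite -!occS; have := cl p i 0; rewrite /occ /=; lia.
  have gd' := good_open 0 clV' gV' gd.
  (* [open] does not renumber: once index 0 is filled, the other variable still has index 1, and the
     closed [V'] adds no occurrence of it. *)
  have occ1 p : occ r p 1 0 (ECmd (open 0 V' d)) <= occ r p 1 0 (ECmd d).
    by apply: leq_trans (occ_open _ _ _ _ clV') _; rewrite andbF.
  split.
  + apply: closed_at0 => p i; apply/eqP; rewrite -leqn0.
    apply: leq_trans (occ_open _ _ _ _ clV) _; case: ifP => // ni.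
    apply: leq_trans (occ_open _ _ _ _ clV') _; case: ifP => // ni'.
    case: i ni ni' => [|[|i]]; rewrite ?cld // ?andbT ?andbF.
    * by move: u0'; case: p; case: (vpol V') => //= ->.
    * by move: u1'; case: p; case: (vpol V) => //= ->.
  + exact: good_open.
  + have := weight_open r 1 V (open 0 V' d).
    have := weight_open r 0 V' d.
    have := leq_mul (leq_trans (occ1 (vpol V)) u1) (leqnn (weight r (EVal V))).
    have := leq_mul u0 (leqnn (weight r (EVal V'))).
    by rewrite /weight /= !weight1 /weight /=; lia.
- move=> V d cl /andP[gV /andP[u gd]].
  have [|||||? ? le] := @substitution_step r V d => //.
  (* The count in [Bang V] is [r] times the count in [V], so [r > 0] is what yields closedness of
     [V]. *)
  + move=> p i m; have /eqP := cl p i m.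
    by rewrite /occ /= !add0n addn_eq0 muln_eq0 (gtn_eqF r_gt0) => /andP[/eqP].
  + by apply: body => p i m; have := cl p i m; rewrite /occ /=; lia.
  by split=> //; move: le; rewrite /weight /= !weight1 /weight /=; lia.
Qed.

Lemma normalizes_within_weight (c : cmd) :
  closed r (ECmd c) -> good r (ECmd c) ->
  cmd_normalizes_within (weight r (ECmd c)) c.
Proof.
move: {2}(weight r (ECmd c)) (leqnn (weight r (ECmd c))) => n.
(* Reducibility is split on classically. When the bound is 0 a step is impossible, as the weight
   would have to drop below 0. *)
elim: n c => [|n IH] c le cl gd;
  have [[c' rd]|nf] := classic (exists c', red c c').
- by have [_ _] := red_decreases cl gd rd; lia.
- by exists 0, c; split=> //;
    [exact: steps0 | move=> c' rd; apply: nf; exists c'].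
- have [cl' gd' lt] := red_decreases cl gd rd.
  have [|k [c'' [kle st nf]]] := IH c' _ cl' gd'; first by lia.
  by exists k.+1, c''; split=> //; [lia | apply: stepsS rd st].
- by exists 0, c; split=> //;
    [exact: steps0 | move=> c' rd; apply: nf; exists c'].
Qed.

End Reduction.

Definition size_expr (Kp Kn : Type) (e : expr Kp Kn) : nat :=
  match e with
  | EPval W => size_pval W
  | EVal V => size_val V
  | EPterm t => size_pterm t
  | ENterm t => size_nterm t
  | ECmd c => size_cmd c
  end.

Lemma size_trav (Kp Kn : Type) (f : nat -> lvar -> pvalue Kp Kn) g k
    (e : expr Kp Kn) :
  (forall k v, size_pval (f k v) = 1) -> (forall k v, size_nterm (g k v) = 1) ->
  size_expr (trav f g k e) = size_expr e.
Proof.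
move=> sf sg; elim/expr_mutind: e k => //= *;
  do ?match goal with IH : forall _, _ = _ |- _ => rewrite IH end;
  by [].
Qed.

(** * Free occurrences and the invariant of typed terms *)

Section Typing.
Context {Kp Kn : Type}.
Variable r : nat.
Hypothesis r_gt0 : 0 < r.
Local Notation expr := (expr Kp Kn).
Local Notation cmd := (cmd Kp Kn).

Definition is_free (P : pred var) (q : pol) (v : lvar) : nat :=
  if v is Free x then P (q, x) : nat else 0.

(** The exponential weighting is that of [occ], so that closing a name transfers its free count to
    the count of the new index. *)
Definition free (P : pred var) (e : expr) : nat :=
  sum r 0 (fun _ => is_free P) 0 e.

Lemma free_depth P m (c : cmd) :
  sum_cmd r 0 (fun _ => is_free P) m c = free P (ECmd c).
Proof. exact: (sum_const_depth _ _ _ _ _ (ECmd c)). Qed.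

Lemma weight_depth m (c : cmd) :
  sum_cmd r 1 (fun _ _ _ => 1) m c = weight r (ECmd c).
Proof. exact: (sum_const_depth _ _ _ _ _ (ECmd c)). Qed.

Lemma sub_free (P Q : pred var) e :
  (forall x, P x -> Q x) -> free P e <= free Q e.
Proof.
move=> PQ; apply: leq_sum_expr => // m q [x|n] //=.
by have := PQ (q, x); case: (P _) => // ->.
Qed.

Lemma free_pred0 (P : pred var) e : (forall x, ~~ P x) -> free P e = 0.
Proof.
move=> P0; rewrite -[RHS](@sum0 Kp Kn r 0 e); apply: eq_sum => m q [x|n] //=.
by rewrite (negPf (P0 _)).
Qed.

Lemma free_mem1 x e : free (mem [:: x]) e = free (pred1 x) e.
Proof.
by apply: eq_sum => m q [y|n] //; rewrite /is_free -[mem _ _]/(_ \in _) inE.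
Qed.

Lemma occ_close p j i xs (c : cmd) :
  occ r p j 0 (ECmd (close i xs c)) <=
  occ r p j 0 (ECmd c) +
  free (fun x => (x.1 == p) && (x \in xs)) (ECmd c) * (j == i).
Proof.
rewrite /occ /close.
rewrite -[ECmd (trav_cmd _ _ _ _)]/(trav _ _ (0 + 0) (ECmd c)) sum_trav.
apply: sum_le => // m q v; rewrite addn0.
by case: q v => -[x|n] /=; rewrite ?leq_addr //; case: (_ \in xs);
  rewrite //= eqn_add2r andbT [i == j]eq_sym mulnb.
Qed.

Lemma free_close P i xs (c : cmd) :
  free P (ECmd (close i xs c)) <= free (fun x => P x && (x \notin xs)) (ECmd c).
Proof.
rewrite /free /close.
rewrite -[ECmd (trav_cmd _ _ _ _)]/(trav _ _ (0 + 0) (ECmd c)) sum_trav.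
apply: leq_sum_expr => // m q v.
by case: q v => -[x|n] //=; case: (_ \in xs); rewrite //= ?andbT.
Qed.

Lemma weight_close i xs (c : cmd) :
  weight r (ECmd (close i xs c)) = weight r (ECmd c).
Proof.
rewrite /weight /close.
rewrite -[ECmd (trav_cmd _ _ _ _)]/(trav _ _ (0 + 0) (ECmd c)) sum_trav.
by apply: eq_sum => m [].
Qed.

Lemma size_close i xs (c : cmd) : size_cmd (close i xs c) = size_cmd c.
Proof. exact: (@size_trav _ _ _ _ 0 (ECmd c)). Qed.

Lemma good_close i xs (c : cmd) :
  good r (ECmd c) -> good r (ECmd (close i xs c)).
Proof.
have lt d m x p j q : j < d ->
    is_bound p j m q (close_lvar q xs (i + (m + d)) x) <= is_bound p j m q x.
  by case: x => [x|n] //= jd; case: ifP => //= _;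
    rewrite (_ : (_ == j + m) = false) ?andbF //; lia.
by apply: (@good_trav _ _ r 0 _ _ (ECmd c)) => //= d m v p j; apply: lt.
Qed.

(** Here [n] stands for the size and [d] for the depth of a derivation: [n] symbols, each inside at
    most [d] exponentials, weigh at most [n * r ^ d]. For [r > 1], [bounded_linear] keeps free names
    out of exponentials; [bounded_free] limits how many occurrences a [MuBang] can merge. *)
Record bounded (d n : nat) (G : ctx) (e : expr) : Prop := Bounded {
  bounded_good : good r e;
  bounded_support : free (fun x => x \notin dom G) e = 0;
  bounded_linear : forall x, free (pred1 x) e <= 1;
  bounded_free : free predT e <= n;
  bounded_weight : weight r e <= n * r ^ d }.

Definition sound d n G e : Prop := closed r e /\ bounded d n G e.

Lemma bounded_notin d n G e x : bounded d n G e -> x \notin dom G ->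
  free (pred1 x) e = 0.
Proof.
move=> se xG; apply/eqP; rewrite -leqn0 -(bounded_support se).
by apply: sub_free => y /eqP->.
Qed.

(** Contexts enter through their domains, so exchange, conversion and weakening all become an
    inclusion of domains. *)
Lemma sound_sub d n G G' e : {subset dom G <= dom G'} ->
  sound d n G e -> sound d n G' e.
Proof.
move=> sGG' [cl [? supp *]]; split=> //; split=> //; apply/eqP;
  rewrite -leqn0 -supp.
by apply: sub_free => x; apply: contra => /sGG'.
Qed.

(** Common to pairs and cuts. Disjointness preserves linearity: a name declared on one side has no
    occurrence on the other. *)
Lemma sound_node d d' n n' G D e e1 e2 :
  (forall s h m, sum r s h m e = s + (sum r s h m e1 + sum r s h m e2)) ->
  good r e = good r e1 && good r e2 ->
  sound d n G e1 -> sound d' n' D e2 -> disjoint_ctx G D ->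
  sound (maxn d d') (n + n').+1 (G ++ D) e.
Proof.
move=> sumE goodE [cl1 s1] [cl2 s2] GD; split.
  by move=> p i m; rewrite /occ sumE -!/(occ _ _ _ _ _) cl1 cl2.
split.
- by rewrite goodE (bounded_good s1) (bounded_good s2).
- have sub F e0 : {subset dom F <= dom (G ++ D)} ->
      free (fun x => x \notin dom (G ++ D)) e0 <=
      free (fun x => x \notin dom F) e0.
    by move=> sF; apply: sub_free => x; apply: contra => /sF.
  have := sub G e1; have := sub D e2.
  rewrite /dom map_cat (bounded_support s1) (bounded_support s2) !leqn0.
  move=> /(_ _)/eqP z2 /(_ _)/eqP z1;
    rewrite /free sumE -!/(free _ _) z1 ?z2 //.
  + by move=> x xD; rewrite mem_cat xD orbT.
  + by move=> x xG; rewrite mem_cat xG.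
- move=> x; rewrite /free sumE -!/(free _ _) add0n.
  have [xG|xG] := boolP (x \in dom G).
    rewrite (bounded_notin s2) ?addn0 ?(bounded_linear s1) //.
    by apply: contra GD => xD; apply/hasP; exists x.
  by rewrite (bounded_notin s1) // (bounded_linear s2).
- rewrite /free sumE -!/(free _ _).
  by have := bounded_free s1; have := bounded_free s2; lia.
- rewrite /weight sumE -!/(weight _ _) mulSn mulnDl !leq_add //.
  + by rewrite expn_gt0 r_gt0.
  + apply: leq_trans (bounded_weight s1) _.
    by rewrite leq_mul2l leq_pexp2l ?orbT ?leq_maxl.
  + apply: leq_trans (bounded_weight s2) _.
    by rewrite leq_mul2l leq_pexp2l ?orbT ?leq_maxr.
Qed.

(** * Preservation of the invariant by binders *)

Lemma bounded_close d n G D i xs (c : cmd) :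
  (forall x, x \in dom D -> (x \in xs) || (x \in dom G)) ->
  bounded d n D (ECmd c) -> bounded d n G (ECmd (close i xs c)).
Proof.
move=> sDG [gc supp lin fr w]; split.
- exact: good_close.
- apply/eqP; rewrite -leqn0 -supp; apply: leq_trans (free_close _ _ _ _) _.
  apply: sub_free => x; rewrite -negb_or; apply: contra => /sDG.
  by rewrite orbC.
- move=> x; apply: leq_trans (free_close _ _ _ _) (leq_trans _ (lin x)).
  by apply: sub_free => y /andP[].
- by apply: leq_trans (free_close _ _ _ _) (leq_trans _ fr); apply: sub_free.
- by rewrite weight_close.
Qed.

(** The depth [k] is left existential because [MuPair] crosses two binders and the others one; the
    sums used here do not depend on depth. *)
Lemma bounded_bind d n G e (c : cmd) :
  (forall s h m, exists k, sum r s h m e = s + sum_cmd r s h k c) ->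
  good r e -> bounded d n G (ECmd c) -> bounded d n.+1 G e.
Proof.
move=> sumE ge [gc supp lin fr w].
have freeE P : free P e = free P (ECmd c).
  by rewrite /free; have [k ->] := sumE 0 (fun _ => is_free P) 0;
    rewrite free_depth.
split=> //;
  [by rewrite freeE | by move=> x; rewrite freeE | by rewrite freeE leqW |].
rewrite /weight; have [k ->] := sumE 1 (fun _ _ _ => 1) 0.
by rewrite weight_depth mulSn leq_add // expn_gt0 r_gt0.
Qed.

(** Index 0 does not dangle in the closed [c], so all its occurrences come from the names in [xs],
    which share the polarity [p]. *)
Lemma uses_close b p xs (c : cmd) :
  closed r (ECmd c) -> all (fun x => x.1 == p) xs ->
  free (mem xs) (ECmd c) <= b -> uses_at_most r b p 0 (close 0 xs c).
Proof.
move=> cl /allP xsp fr; apply/andP; split.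
- apply: leq_trans (occ_close _ _ _ _ _) _; rewrite cl eqxx muln1.
  by apply: leq_trans fr; apply: sub_free => x /andP[].
- rewrite -leqn0; apply: leq_trans (occ_close _ _ _ _ _) _.
  rewrite cl free_pred0 // => x; apply/andP => -[/eqP e /xsp].
  by rewrite e; case: (p).
Qed.

Lemma closed_close xs (c : cmd) p i :
  closed r (ECmd c) -> occ r p i.+1 0 (ECmd (close 0 xs c)) = 0.
Proof.
move=> cl; apply/eqP; rewrite -leqn0; apply: leq_trans (occ_close _ _ _ _ _) _.
by rewrite cl muln0.
Qed.

Lemma sound_binder d n G D b p xs (c : cmd) e :
  (forall s h m, sum r s h m e = s + sum_cmd r s h m.+1 (close 0 xs c)) ->
  good r e = uses_at_most r b p 0 (close 0 xs c) &&
    good r (ECmd (close 0 xs c)) ->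
  all (fun x => x.1 == p) xs -> free (mem xs) (ECmd c) <= b ->
  (forall x, x \in dom D -> (x \in xs) || (x \in dom G)) ->
  sound d n D (ECmd c) -> sound d n.+1 G e.
Proof.
move=> sumE goodE xsp fr sDG [cl bd].
have bd' := bounded_close 0 sDG bd.
have ge : good r e by rewrite goodE uses_close // (bounded_good bd').
split; last by apply: bounded_bind bd' => // s h m; exists m.+1.
apply: closed_at0 => // q i; rewrite /occ sumE.
by have := closed_close xs q i cl; rewrite -occS.
Qed.

Lemma sound_pair_binder d n G (x y : var) A B (c : cmd) :
  sound d n ((x, A) :: (y, B) :: G) (ECmd c) ->
  sound d n.+1 G
    (ENterm (MuPair x.1 y.1 (close 1 [:: x] (close 0 [:: y] c)))).
Proof.
move=> [cl bd].
have bd0 : bounded d n ((x, A) :: G) (ECmd (close 0 [:: y] c)).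
  by apply: bounded_close bd => z; rewrite /= !inE orbCA.
have bd1 : bounded d n G (ECmd (close 1 [:: x] (close 0 [:: y] c))).
  by apply: bounded_close bd0 => z; rewrite /= !inE.
(* Index 0 comes from the inner closing of [y], index 1 from the occurrences of [x] that this
   closing leaves free. *)
have occE p i : occ r p i 0 (ECmd (close 1 [:: x] (close 0 [:: y] c))) <=
    free (fun z => (z.1 == p) && (z == y)) (ECmd c) * (i == 0) +
    free (fun z => (z.1 == p) && (z == x)) (ECmd c) * (i == 1).
  apply: leq_trans (occ_close _ _ _ _ _) _; apply: leq_add.
    apply: leq_trans (occ_close _ _ _ _ _) _; rewrite cl add0n.
    by rewrite leq_mul2r sub_free ?orbT // => z; rewrite inE.
  rewrite leq_mul2r; apply/orP; right.
  apply: leq_trans (free_close _ _ _ _) (sub_free _ _) => z.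
  by rewrite !inE => /andP[].
have le1 z p : free (fun t => (t.1 == p) && (t == z)) (ECmd c) <= 1.
  by apply: leq_trans (bounded_linear bd z); apply: sub_free => t /andP[].
have eq0 z : free (fun t => (t.1 == Defs.opp z.1) && (t == z)) (ECmd c) = 0.
  by apply: free_pred0 => t; apply/andP => -[/eqP e /eqP tz]; move: e;
    rewrite tz; case: (z.1).
have ge : good r (ENterm (MuPair x.1 y.1 (close 1 [:: x] (close 0 [:: y] c)))).
  rewrite /= [good_cmd _ _](bounded_good bd1) andbT; apply/andP; split.
  - apply/andP; split; [|rewrite -leqn0]; apply: leq_trans (occE _ _) _.
      by rewrite muln0 muln1 add0n.
    by rewrite eq0 muln0.
  - apply/andP; split; [|rewrite -leqn0]; apply: leq_trans (occE _ _) _.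
      by rewrite muln0 muln1 addn0.
    by rewrite eq0 muln0.
split; last by apply: bounded_bind bd1 => // s h m; exists m.+2.
apply: closed_at0 => // p i; apply/eqP; rewrite -leqn0.
have := occE p i.+2; rewrite !muln0 -!occS.
by rewrite /occ /=.
Qed.

(** * Exponential boxes *)

Definition pos_vars (xs : seq nat) : seq var := [seq (Pos, x) | x <- xs].

Lemma free_bang_cons P a x xs (V : value Kp Kn) :
  free P (ECmd (bang_cmd a (x :: xs) V)) =
  P (Pos, x) + free P (ECmd (close 0 [:: (Pos, x)] (bang_cmd a xs V))).
Proof. by rewrite -(free_depth P 1 (close _ _ _)). Qed.

(** Each name of [xs] is exposed once, in a cut outside the [Bang], while its occurrences in [V] are
    captured by the matching [MuBang]. Any other free name of [V] stays under the [Bang] and costs a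
    factor [r]. *)
Lemma free_bang_cmd P a xs (V : value Kp Kn) :
  free P (ECmd (bang_cmd a xs V)) <=
  P (Neg, a) + count P (pos_vars xs) +
  r * free (fun x => P x && (x \notin pos_vars xs)) (EVal V).
Proof.
elim: xs P => [|x xs IH] P.
  rewrite /free /= !add0n addn0 addnC leq_add2l leq_mul2l.
  by apply/orP; right; apply: (sub_free (EVal V)) => z ->.
rewrite free_bang_cons.
set Q := fun y => P y && (y \notin [:: (Pos, x)]).
have le1 : free P (ECmd (close 0 [:: (Pos, x)] (bang_cmd a xs V))) <= _ :=
  leq_trans (free_close _ _ _ _) (IH Q).
have le2 : free (fun y => Q y && (y \notin pos_vars xs)) (EVal V) <=
    free (fun y => P y && (y \notin (Pos, x) :: pos_vars xs)) (EVal V).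
  by apply: sub_free => y; rewrite /Q !inE negb_or -andbA.
have le3 : count Q (pos_vars xs) <= count P (pos_vars xs).
  by apply: sub_count => y /andP[].
have le4 : Q (Neg, a) <= P (Neg, a) by rewrite /Q; case: (P _).
have := leq_mul (leqnn r) le2; move: le1 le3 le4.
by rewrite /pos_vars /=; lia.
Qed.

(** Sharper than [free_bang_cmd] for a single name: if [z] is repeated in [xs], closing it at its
    outermost position captures all the inner occurrences, so one remains. *)
Lemma free1_bang_cmd z a xs (V : value Kp Kn) :
  free (pred1 z) (ECmd (bang_cmd a xs V)) <=
  if z \in pos_vars xs then 1
  else ((Neg, a) == z) + r * free (pred1 z) (EVal V).
Proof.
elim: xs => [|x xs IH].
  by rewrite /free /= !add0n addnC.
rewrite free_bang_cons -[pos_vars _]/((Pos, x) :: pos_vars xs) in_cons.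
rewrite -[pred1 z _]/((Pos, x) == z) [z == _]eq_sym.
apply: leq_trans (leq_add (leqnn _) (free_close _ _ _ _)) _.
have [<-|xz] := eqVneq (Pos, x) z.
  by rewrite free_pred0 // => y; rewrite !inE andbN.
by apply: leq_trans IH; apply: sub_free => y /andP[].
Qed.

Lemma bang_cmd_sound d (L : seq (nat * con 0)) a (V : value Kp Kn) :
  sound d (size_val V) (decls Pos L) (EVal V) ->
  let c := bang_cmd a [seq l.1 | l <- L] V in
  [/\ closed r (ECmd c), good r (ECmd c) &
      weight r (ECmd c) <= size_cmd c * r ^ d.+1].
Proof.
move=> [cl bd] c.
have notin x : x \notin pos_vars [seq l.1 | l <- L] ->
    free (pred1 x) (EVal V) = 0.
  by move=> xL; apply: (bounded_notin bd); rewrite /dom /decls -map_comp;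
    move: xL; rewrite /pos_vars -map_comp.
have lin := bounded_linear bd; have w := bounded_weight bd.
have rd : 0 < r ^ d.+1 by rewrite expn_gt0 r_gt0.
rewrite {}/c; elim: [seq l.1 | l <- L] => [|x xs [clx gx wx]] /=.
  split.
  - by move=> p i m; rewrite /occ /= !add0n [sum_val _ _ _ _ _]cl muln0.
  - by rewrite andbT; apply: (bounded_good bd).
  - have := leq_mul (leqnn r) w; rewrite mulnCA -expnS /weight /=; nia.
(* Either [x] comes again in [xs] and is exposed once, or its only possible occurrence lies in [V],
   hence under one more [Bang], and counts for at most [r]. *)
have uses : uses_at_most r r Pos 0 (close 0 [:: (Pos, x)] (bang_cmd a xs V)).
  apply: uses_close => //.
  rewrite free_mem1; apply: leq_trans (free1_bang_cmd _ _ _ _) _;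
    case: ifP => // _.
  by rewrite -[X in _ <= X]muln1 leq_mul2l lin orbT.
split.
- apply: closed_at0 => // p i; rewrite /occ /= !add0n.
  by have := closed_close [:: (Pos, x)] p i clx; rewrite -occS.
- by rewrite uses; apply: (@good_close 0 _ (bang_cmd a xs V)).
- rewrite /weight /= weight_depth weight_close size_close.
  by move: wx; nia.
Qed.

Lemma bang_sound d (L : seq (nat * con 0)) (V : value Kp Kn) :
  sound d (size_val V) (decls Pos L) (EVal V) ->
  sound d.+1 (size_pterm (bang [seq l.1 | l <- L] V))
    (decls Pos [seq (l.1, CWhy l.2) | l <- L])
    (EPterm (bang [seq l.1 | l <- L] V)).
Proof.
move=> sV; rewrite /bang; set a := fresh_name _; set xs := map _ L.
have [cl gd w] := bang_cmd_sound a sV; case: sV => clV bd.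
have domE (f : con 0 -> con 0) :
    dom (decls Pos [seq (l.1, f l.2) | l <- L]) = pos_vars xs.
  by rewrite /dom /decls /pos_vars /xs -!map_comp.
have domL : dom (decls Pos L) = pos_vars xs.
  by rewrite /dom /decls /pos_vars /xs -!map_comp.
have supp P : free (fun x => P x && (x \notin pos_vars xs)) (EVal V) = 0.
  apply/eqP; rewrite -leqn0 -(bounded_support bd) domL.
  by apply: sub_free => x /andP[].
have notin z : z \notin pos_vars xs -> free (pred1 z) (EVal V) = 0.
  by move=> zx; apply: (bounded_notin bd); rewrite domL.
(* The inequality is strict to leave room for [a], which is free beside the names of [xs]. *)
have sizeE : size (pos_vars xs) < size_cmd (bang_cmd a xs V).
  rewrite size_map; elim: (xs) => [|x ys IH] //=; rewrite size_close; lia.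
have lin z : free (pred1 z) (ECmd (bang_cmd a xs V)) <= 1.
  apply: leq_trans (free1_bang_cmd _ _ _ _) _;
    case: ifPn => // zx.
  by rewrite notin // muln0 addn0; case: eqP.
rewrite /= size_close.
(* [CZero] is a placeholder for the formula of [a]: [sound] reads the names of a context. *)
have sc : sound d.+1 (size_cmd (bang_cmd a xs V))
    (((Neg, a), CZero) :: decls Pos [seq (l.1, CWhy l.2) | l <- L])
    (ECmd (bang_cmd a xs V)).
  split=> //; split=> //.
  - apply/eqP; rewrite -leqn0; apply: leq_trans (free_bang_cmd _ _ _ _) _.
    rewrite supp muln0 addn0 /= domE inE eqxx /= add0n leqn0.
    rewrite -[_ == 0]negbK -lt0n -has_count; apply/hasPn => z zx.
    by rewrite inE zx orbT.
  - apply: leq_trans (free_bang_cmd _ _ _ _) _.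
    by rewrite supp muln0 addn0 count_predT.
apply: (sound_binder (b := 1) (p := Neg)) sc => //.
- by rewrite free_mem1.
- by move=> x; rewrite /= !inE.
Qed.

(** * The invariant for all derivations *)

Lemma sound_unary d n G e e1 :
  (forall s h m, sum r s h m e = s + sum r s h m e1) ->
  good r e = good r e1 -> sound d n G e1 -> sound d n.+1 G e.
Proof.
move=> sumE goodE [cl bd]; split.
  by move=> p i m; rewrite /occ sumE; apply: cl.
have freeE P : free P e = free P e1 by rewrite /free sumE.
split; rewrite ?freeE ?goodE.
- exact: (bounded_good bd).
- exact: (bounded_support bd).
- by move=> x; rewrite freeE (bounded_linear bd).
- exact/leqW/(bounded_free bd).
- by rewrite /weight sumE mulSn leq_add ?(bounded_weight bd) // expn_gt0 r_gt0.
Qed.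

Lemma sound_var x A (e : expr) :
  (forall s h m, sum r s h m e = h m x.1 (Free x.2)) -> good r e ->
  sound 0 1 [:: (x, A)] e.
Proof.
move=> sumE ge; split; first by move=> p i m; rewrite /occ sumE.
split=> //.
- by rewrite /free sumE /is_free -surjective_pairing inE eqxx.
- by move=> y; rewrite /free sumE /=; case: eqP.
- by rewrite /free sumE.
- by rewrite /weight sumE.
Qed.

Lemma perm_dom (G G' : ctx) : Permutation G G' -> {subset dom G <= dom G'}.
Proof.
elim=> {G G'} [|x G G' _ IH|x y G|G G' G'' _ IH _ IH'] // z.
- by rewrite !inE => /orP[->//|/IH->]; rewrite orbT.
- by rewrite !inE orbCA.
- by move/IH/IH'.
Qed.

Definition expr_of_term (t : term Kp Kn) : expr :=
  match t with TPos t => EPterm t | TNeg t => ENterm t end.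

Lemma sound_value d n G (V : value Kp Kn) :
  sound d n G (expr_of_term (term_of_value V)) <-> sound d n G (EVal V).
Proof.
by case: V => ?; split=> -[cl [*]]; split=> //; split.
Qed.

(** The parameter [r] stays fixed while sizes shrink along the derivation. That the size is at most
    [r] is spent at [dt_mult], where it bounds the number of merged occurrences. *)
Lemma derivation_sound :
  (forall t A G (D : dterm t A G), term_size t <= r ->
     sound (depth D) (term_size t) G (expr_of_term t)) /\
  (forall c G (D : dcmd c G), size_cmd c <= r ->
     sound (depth_cmd D) (size_cmd c) G (ECmd c)).
Proof.
have vsize (V : value Kp Kn) : term_size (term_of_value V) = size_val V
  by case: V.
apply: derivation_mutind => /=.
- by move=> t A G G' GG' D IH le; apply: sound_sub (perm_dom GG') (IH le).
- by move=> x P _ _; apply: sound_var.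
- by move=> a N _ _; apply: sound_var.
- move=> a c P G D IH; rewrite size_close => le.
  apply: (sound_binder (b := 1) (p := Neg)) (IH (ltnW le)) => //.
  + by rewrite free_mem1; have [_ /bounded_linear] := IH (ltnW le).
  + by move=> x; rewrite /= !inE.
- move=> x c N G D IH; rewrite size_close => le.
  apply: (sound_binder (b := 1) (p := Pos)) (IH (ltnW le)) => //.
  + by rewrite free_mem1; have [_ /bounded_linear] := IH (ltnW le).
  + by move=> y; rewrite /= !inE.
- move=> V V' A B G G' D IH D' IH' GG' le.
  rewrite !vsize in IH IH'.
  have /sound_value s1 := IH ltac:(lia); have /sound_value s2 := IH' ltac:(lia).
  exact: (sound_node _ _ s1 s2).
- move=> x y c A B G D IH; rewrite !size_close => le.
  exact: sound_pair_binder (IH (ltnW le)).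
- move=> V A G D IH le; rewrite vsize in IH.
  by have /sound_value s1 := IH (ltnW le); apply: sound_unary s1.
- move=> x c A G D IH; rewrite size_close => le.
  apply: (sound_binder (b := 1) (p := x.1)) (IH (ltnW le)) => //.
  + by rewrite /= eqxx.
  + by rewrite free_mem1; have [_ /bounded_linear] := IH (ltnW le).
  + by move=> y; rewrite /= !inE.
(* The two quantifier rules change neither the term nor the depth. *)
- by [].
- by [].
- move=> V A L D IH le; rewrite vsize in IH.
  apply: bang_sound; apply/sound_value/IH; apply: leq_trans le.
  rewrite size_close; elim: [seq _ | _ <- _] => [|x xs IHxs] /=; first by lia.
  by rewrite size_close; lia.
- move=> p xs c A G _ D IH; rewrite size_close => le.
  apply: (sound_binder (b := r) (p := p)) (IH (ltnW le)) => //.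
  + by apply/allP => _ /mapP[x _ ->] /=.
  (* The merged occurrences are among the free occurrences of the body, hence at most its size. The
     length of [xs] would not do, since weakening can add names that do not occur. *)
  + have [_ /bounded_free fr] := IH (ltnW le).
    apply: leq_trans (sub_free _ _) (leq_trans fr (ltnW le)) => //.
  + by move=> x; rewrite /dom map_cat mem_cat -map_comp.
- by move=> c G G' GG' D IH le; apply: sound_sub (perm_dom GG') (IH le).
- move=> t u A G D Dt IH Du IH' GD le.
  exact: (sound_node _ _ (IH ltac:(lia)) (IH' ltac:(lia))).
- by move=> x A B c G _ _ D IH le; apply: sound_sub (IH le).
- move=> x A c G _ _ D IH le; apply: sound_sub (IH le) => y.
  by rewrite inE => ->; rewrite orbT.
Qed.

End Typing.

(** * The polynomial bound *)

Theorem theorem67 (Kp Kn : Type) :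
  exists P : nat -> {poly nat},
    forall (t : term Kp Kn) (A : con 0) (d : dterm t A [::]),
      normalizes_within ((P (depth d)).[term_size t])%R t.
Proof.
(* Taking [r] to be the size [n] itself, the term weighs at most [n * n ^ k]; the constant 2 pays
   for the cut and the fresh variable of [against t x]. *)
exists (fun k => 'X^(k.+1) + 2%:P)%R => t A d x _.
set n := term_size t.
have n_gt0 : 0 < n by rewrite /n; case: (t) => -[] // [].
have [] := (derivation_sound n_gt0).1 t A [::] d (leqnn n).
rewrite hornerD hornerXn hornerC GRing.exprS.
move: (depth d) => k cl [gd _ _ _ w].
have wc : weight n (ECmd (against t x)) <= n * n ^ k + 2.
  by move: w; rewrite -expnS /weight; case: (t) => u /=; lia.
have [||l [c' [lle st nf]]] :=
    @normalizes_within_weight _ _ n n_gt0 (against t x).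
- by move=> p i m; have := cl p i m; rewrite /occ; case: (t) => u /=; lia.
- by move: gd; case: (t) => u /=; rewrite ?andbT.
by exists l, c'; split=> //; apply: leq_trans lle wc.
Qed.
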